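(* Let $(\Omega,\mu)$ be a measure space, and take $q\in[1,\infty)$. Then the standard $q$-multi-norm and the $(1,q)$-multi-norm based on $L^1(\Omega,\mu)$ are equal, that is, $\|(f_1,\dots,f_n)\|_n^{[q]}=\|(f_1,\dots,f_n)\|_n^{(1,q)}$ for each $n\in\mathbb N$ and $f_1,\dots,f_n\in L^1(\Omega,\mu)$.
   Context: $L^1(\Omega,\mu)$ is the complex Banach space of (classes of) integrable functions. Standard $q$-multi-norm on $E=L^1(\Omega,\mu)$: $\|(f_1,\dots,f_n)\|_n^{[q]}=\sup_{\mathbf X}\big(\sum_{i=1}^n\big(\int_{X_i}|f_i|\,d\mu\big)^q\big)^{1/q}$, where the supremum is over all ordered partitions $\mathbf X=(X_1,\dots,X_n)$ of $\Omega$ into pairwise-disjoint measurable subsets (some possibly empty). $(1,q)$-multi-norm on $E$: $\|(f_1,\dots,f_n)\|_n^{(1,q)}=\sup\{(\sum_{i=1}^n|\langle f_i,\lambda_i\rangle|^q)^{1/q}:\lambda_1,\dots,\lambda_n\in E',\ \mu_{1,n}(\lambda_1,\dots,\lambda_n)\le1\}$, where $E'$ is the dual space of $E$ and $\mu_{1,n}(\lambda_1,\dots,\lambda_n)=\sup\{\sum_{j=1}^n|\langle f,\lambda_j\rangle|:f\in E,\|f\|\le1\}$. *)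

(* Defs.v *)
From HB Require Import structures.
From mathcomp Require Import all_boot all_order all_algebra.
From mathcomp Require Import all_classical all_reals all_analysis.
From mathcomp Require Import measurable_realfun.
From mathcomp Require Import complex.

Set Implicit Arguments.
Unset Strict Implicit.
Unset Printing Implicit Defensive.

Import Order.TTheory GRing.Theory Num.Theory numFieldNormedType.Exports.
Import Normc.

Local Open Scope classical_set_scope.
Local Open Scope ring_scope.
Local Open Scope complex_scope.

(* The measure [mu] is arbitrary: it is not assumed finite or sigma-finite. *)
Section integrable_complex_functions.
Context d (T : measurableType d) (R : realType) (mu : {measure set T -> \bar R}).
Implicit Types f g : T -> R[i].

(* [normc z : R] is the modulus of [z]; [`|z|] is the same real number seen as
   an element of [R[i]]. *)
Definition cintegrable f : Prop :=
  [/\ measurable_fun setT (fun x => complex.Re (f x)),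
      measurable_fun setT (fun x => complex.Im (f x)) &
      (\int[mu]_x (normc (f x))%:E < +oo)%E].

Lemma normc_sqrtE (z : R[i]) :
  normc z = Num.sqrt (complex.Re z ^+ 2 + complex.Im z ^+ 2).
Proof. by case: z. Qed.

Lemma normc_ge0 (z : R[i]) : 0 <= normc z.
Proof. by rewrite normc_sqrtE sqrtr_ge0. Qed.

Lemma ler_normcD (z w : R[i]) : normc (z + w) <= normc z + normc w.
Proof. exact: (@le_normcD R z w). Qed.

Lemma measurable_normc f :
  measurable_fun setT (fun x => complex.Re (f x)) ->
  measurable_fun setT (fun x => complex.Im (f x)) ->
  measurable_fun setT (fun x => normc (f x)).
Proof.
move=> mRe mIm.
rewrite (_ : (fun x => _) = Num.sqrt \o
  (fun x => complex.Re (f x) ^+ 2 + complex.Im (f x) ^+ 2)); last first.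
  by apply/funext => x; rewrite /= normc_sqrtE.
apply: measurableT_comp.
  by apply: continuous_measurable_fun; exact: sqrt_continuous.
by apply: measurable_funD; exact: measurable_funX.
Qed.

Lemma cintegrable_normc f :
  cintegrable f -> mu.-integrable setT (fun x => (normc (f x))%:E).
Proof.
move=> [mRe mIm fi]; apply/integrableP; split.
  by apply/measurable_EFinP; exact: measurable_normc.
apply: le_lt_trans fi; rewrite le_eqVlt; apply/orP; left; apply/eqP.
by apply: eq_integral => x _; rewrite gee0_abs// lee_fin normc_ge0.
Qed.

Definition cL1fun_pred : {pred T -> R[i]} := mem [set f | cintegrable f].

Lemma cL1fun_submod_closed : submod_closed cL1fun_pred.
Proof.
split.
  rewrite inE /=; split; [exact: measurable_cst..|].
  under eq_integral do rewrite normc0.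
  by rewrite integral0.
move=> a f g; rewrite !inE /= => fi gi.
have fE := cintegrable_normc fi; have gE := cintegrable_normc gi.
have [fRe fIm _] := fi; have [gRe gIm _] := gi.
have mRe : measurable_fun setT (fun x => complex.Re ((a *: f + g) x)).
  rewrite (_ : (fun x => _) = (fun x => complex.Re a * complex.Re (f x)
      - complex.Im a * complex.Im (f x) + complex.Re (g x))); last first.
    by apply/funext => x; rewrite !fctE; case: (a) (f x) (g x) => [? ?] [? ?] [].
  by apply: measurable_funD => //; apply: measurable_funB;
    exact: measurable_funM.
have mIm : measurable_fun setT (fun x => complex.Im ((a *: f + g) x)).
  rewrite (_ : (fun x => _) = (fun x => complex.Re a * complex.Im (f x)
      + complex.Im a * complex.Re (f x) + complex.Im (g x))); last first.
    by apply/funext => x; rewrite !fctE; case: (a) (f x) (g x) => [? ?] [? ?] [].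
  by apply: measurable_funD => //; apply: measurable_funD;
    exact: measurable_funM.
split => //.
have /integrableP[_] := integrableD measurableT
  (integrableZl measurableT (normc a) fE) gE.
apply: le_lt_trans; apply: ge0_le_integral => //.
- by move=> x _; rewrite lee_fin normc_ge0.
- by apply/measurable_EFinP; exact: measurable_normc.
- apply/measurable_EFinP; apply: measurableT_comp => //.
  by apply: measurable_funD; [apply: measurable_funM => //|];
    exact: measurable_normc.
- move=> x _; rewrite /= lee_fin ger0_norm; last first.
    by rewrite addr_ge0// ?mulr_ge0// normc_ge0.
  by rewrite (le_trans (ler_normcD _ _))// lerD2r -normcM.
Qed.

HB.instance Definition _ :=
  GRing.isSubmodClosed.Build _ _ cL1fun_pred cL1fun_submod_closed.

Record cL1fun := CL1fun {
  cL1fun_val :> T -> R[i] ;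
  cL1fun_mem : cL1fun_val \in cL1fun_pred }.

HB.instance Definition _ := [isSub for cL1fun_val].
HB.instance Definition _ := [Choice of cL1fun by <:].
HB.instance Definition _ := [SubChoice_isSubLmodule of cL1fun by <:].

Lemma cL1funP (f : cL1fun) : cintegrable f.
Proof. by have := cL1fun_mem f; rewrite inE. Qed.

End integrable_complex_functions.

Section complex_L1.
Context d (T : measurableType d) (R : realType) (mu : {measure set T -> \bar R}).
Local Open Scope quotient_scope.

Definition cL1_eq (f g : cL1fun mu) : bool := `[< {ae mu, forall x, f x = g x} >].

Let cL1_eq_refl : reflexive cL1_eq.
Proof. by move=> f; apply/asboolP; exact: aeW. Qed.

Let cL1_eq_sym : symmetric cL1_eq.
Proof.
by move=> f g; apply/idP/idP => /asboolP fg; apply/asboolP; move: fg;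
  apply: filterS => x ->.
Qed.

Let cL1_eq_trans : transitive cL1_eq.
Proof.
move=> f g h /asboolP gf /asboolP fh; apply/asboolP.
by move: gf fh; apply: filterS2 => x -> ->.
Qed.

Canonical cL1_eq_canonical :=
  EquivRel cL1_eq cL1_eq_refl cL1_eq_sym cL1_eq_trans.

Definition cL1 : Type := {eq_quot cL1_eq}.
HB.instance Definition _ := Choice.on cL1.
HB.instance Definition _ := EqQuotient.on cL1.

Definition cL1_repr (f : cL1) : T -> R[i] := repr f : cL1fun mu.
Coercion cL1_repr : cL1 >-> Funclass.

Lemma cL1_eqP (f g : cL1fun mu) :
  \pi_cL1 f = \pi_cL1 g <-> {ae mu, forall x, f x = g x}.
Proof.
split; first by move/eqP; rewrite eqmodE => /asboolP.
by move=> fg; apply/eqP; rewrite eqmodE; exact/asboolP.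
Qed.

Lemma cL1_pi_repr (f : cL1fun mu) : {ae mu, forall x, (\pi_cL1 f : cL1) x = f x}.
Proof. by apply/cL1_eqP; rewrite reprK. Qed.

Lemma cL1_ind (P : cL1 -> Prop) : (forall f, P (\pi_cL1 f)) -> forall u, P u.
Proof. by move=> Pf u; rewrite -[u]reprK. Qed.

Definition cL1_zero : cL1 := \pi_cL1 0.
Definition cL1_opp (u : cL1) : cL1 := \pi_cL1 (- repr u).
Definition cL1_add (u v : cL1) : cL1 := \pi_cL1 (repr u + repr v).
Definition cL1_scale (a : R[i]) (u : cL1) : cL1 := \pi_cL1 (a *: repr u).

Lemma cL1_piN f : cL1_opp (\pi_cL1 f) = \pi_cL1 (- f).
Proof.
apply/cL1_eqP; have := cL1_pi_repr f.
by apply: filterS => x /= e; exact: (congr1 -%R e).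
Qed.

Lemma cL1_piD f g : cL1_add (\pi_cL1 f) (\pi_cL1 g) = \pi_cL1 (f + g).
Proof.
apply/cL1_eqP; have := cL1_pi_repr g; have := cL1_pi_repr f.
by apply: filterS2 => x /= e1 e2; exact: (congr2 +%R e1 e2).
Qed.

Lemma cL1_piZ a f : cL1_scale a (\pi_cL1 f) = \pi_cL1 (a *: f).
Proof.
apply/cL1_eqP; have := cL1_pi_repr f.
by apply: filterS => x /= e; exact: (congr1 ( *:%R a) e).
Qed.

Let cL1_addA : associative cL1_add.
Proof.
elim/cL1_ind => f; elim/cL1_ind => g; elim/cL1_ind => h.
by rewrite !cL1_piD addrA.
Qed.

Let cL1_addC : commutative cL1_add.
Proof.
by elim/cL1_ind => f; elim/cL1_ind => g; rewrite !cL1_piD addrC.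
Qed.

Let cL1_add0 : left_id cL1_zero cL1_add.
Proof. by elim/cL1_ind => f; rewrite cL1_piD add0r. Qed.

Let cL1_addN : left_inverse cL1_zero cL1_opp cL1_add.
Proof. by elim/cL1_ind => f; rewrite cL1_piN cL1_piD addNr. Qed.

HB.instance Definition _ :=
  GRing.isZmodule.Build cL1 cL1_addA cL1_addC cL1_add0 cL1_addN.

Let cL1_scaleA a b u : cL1_scale a (cL1_scale b u) = cL1_scale (a * b) u.
Proof. by elim/cL1_ind: u => f; rewrite !cL1_piZ scalerA. Qed.

Let cL1_scale1 : left_id 1 cL1_scale.
Proof. by elim/cL1_ind => f; rewrite cL1_piZ scale1r. Qed.

Let cL1_scaleDr : right_distributive cL1_scale +%R.
Proof.
move=> a; elim/cL1_ind => f; elim/cL1_ind => g.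
by rewrite [X in cL1_scale a X]cL1_piD !cL1_piZ [RHS]cL1_piD scalerDr.
Qed.

Let cL1_scaleDl u : {morph cL1_scale^~ u : a b / a + b}.
Proof.
move=> a b; elim/cL1_ind: u => f.
by rewrite !cL1_piZ [RHS]cL1_piD scalerDl.
Qed.

HB.instance Definition _ := GRing.Zmodule_isLmodule.Build R[i] cL1
  cL1_scaleA cL1_scale1 cL1_scaleDr cL1_scaleDl.

Definition cL1_norm (u : cL1) : R := \int[mu]_x normc (u x).

Lemma cL1_norm_pi (f : cL1fun mu) :
  cL1_norm (\pi_cL1 f) = \int[mu]_x normc (f x).
Proof.
rewrite /cL1_norm /Rintegral; congr fine; apply: ae_eq_integral => //.
- apply/measurable_EFinP; apply: measurable_normc;
    by have [] := cL1funP (repr (\pi_cL1 f)).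
- by apply/measurable_EFinP; apply: measurable_normc; have [] := cL1funP f.
- by have := cL1_pi_repr f; apply: filterS => x /= + _ => ->.
Qed.

Let ler_cL1_normD (u v : cL1) :
  (cL1_norm (u + v))%:C <= (cL1_norm u)%:C + (cL1_norm v)%:C.
Proof.
rewrite -rmorphD lecR; elim/cL1_ind: u => f; elim/cL1_ind: v => g.
rewrite [X in cL1_norm X]cL1_piD !cL1_norm_pi.
have iF h := cintegrable_normc (cL1funP h).
rewrite -RintegralD //; [|exact: iF..].
apply: le_Rintegral => //.
- exact: iF (f + g).
- rewrite (_ : EFin \o _ = (fun x => (normc (f x))%:E) \+
    (fun x => (normc (g x))%:E))%E; last by apply/funext => x; rewrite /= EFinD.
  by apply: integrableD => //; exact: iF.
- by move=> x _; exact: ler_normcD.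
Qed.

Let cL1_normZ (a : R[i]) (u : cL1) :
  (cL1_norm (a *: u))%:C = `|a| * (cL1_norm u)%:C.
Proof.
rewrite normc_def -normc_sqrtE -rmorphM; congr (_%:C); elim/cL1_ind: u => f.
rewrite [X in cL1_norm X]cL1_piZ !cL1_norm_pi.
rewrite -RintegralZl //; last exact: (cintegrable_normc (cL1funP f)).
by apply: eq_Rintegral => x _; rewrite -normcM.
Qed.

Let cL1_norm0_eq0 (u : cL1) : (cL1_norm u)%:C = 0 -> u = 0.
Proof.
move=> [u0]; elim/cL1_ind: u u0 => f; rewrite cL1_norm_pi => f0.
have fi := cintegrable_normc (cL1funP f).
have : (\int[mu]_x `|(normc (f x))%:E| = 0)%E.
  under eq_integral => x _ do rewrite gee0_abs ?lee_fin ?normc_ge0//.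
  rewrite -[LHS]fineK ?integrable_fin_num//.
  by congr (_%:E).
move/(ae_eq_integral_abs mu measurableT (measurable_int _ fi)) => f00.
apply/cL1_eqP; move: f00; apply: filterS => x /= /(_ I) [].
exact: eq0_normc.
Qed.

HB.instance Definition _ := Lmodule_isNormed.Build R[i] cL1
  ler_cL1_normD cL1_normZ cL1_norm0_eq0.

Lemma cL1_normE (u : cL1) : `|u| = (\int[mu]_x normc (u x))%:C.
Proof. by []. Qed.

End complex_L1.

(* The suprema are taken in [\bar R], so that no junk value can occur. *)
Section multi_norms.
Context (R : realType).

Section dual.
Variable E : normedModType R[i].

Record dual := Dual {
  dual_fun :> {linear E -> R[i]^o} ;
  dual_continuous : continuous dual_fun }.

Definition weak_1_summing_norm n (lam : 'I_n -> dual) : \bar R :=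
  ereal_sup [set (\sum_(j < n) normc (lam j x))%:E
            | x in [set x : E | `|x| <= 1]].

Definition multi_norm_1q (q : R) n (f : 'I_n -> E) : \bar R :=
  ereal_sup [set ((\sum_(i < n) normc (lam i (f i)) `^ q) `^ q^-1)%:E
            | lam in [set lam : 'I_n -> dual | (weak_1_summing_norm lam <= 1)%E]].

End dual.

Section standard.
Context d (T : measurableType d) (mu : {measure set T -> \bar R}).

Definition ordered_partition n (X : 'I_n -> set T) : Prop :=
  [/\ forall i, measurable (X i), trivIset setT X & \bigcup_i X i = setT].

Definition standard_multi_norm (q : R) n (f : 'I_n -> cL1 mu) : \bar R :=
  ereal_sup [set ((\sum_(i < n) (\int[mu]_(x in X i) normc (f i x)) `^ q)
                  `^ q^-1)%:E
            | X in [set X : 'I_n -> set T | ordered_partition X]].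

End standard.
End multi_norms.

(* Main.v *)
(* The functionals [g |-> int_{X_i} g conj(f_i)/|f_i|] are admissible and attain
   the value of the partition [X], so the (1,q)-multi-norm dominates.

   For the converse neither the dual of [L^1] nor sigma-finiteness is needed:
   approximate the [f_i] in norm by functions [s_i] constant on the cells [A_k]
   of one finite measurable partition, with [|s_i| <= |f_i|].  With
   [c_ik := |lambda_i(1_{A_k})| / mu(A_k)] one has [sum_i c_ik <= 1] and
   [|lambda_i(s_i)| <= sum_k c_ik int_{A_k} |f_i|], so the sum of the [q]-th
   powers is bounded by a convex function of [c] on a product of simplices, and
   hence by its value at a vertex.  A vertex assigns each cell to an index [i],
   which is an ordered partition. *)
Require Import Defs.
From HB Require Import structures.
From mathcomp Require Import all_boot all_order all_algebra finmap.
From mathcomp Require Import all_classical all_reals all_analysis.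
From mathcomp Require Import measurable_realfun.
From mathcomp Require Import complex.
From mathcomp Require Import ring lra.

Set Implicit Arguments.
Unset Strict Implicit.
Unset Printing Implicit Defensive.

Import Order.TTheory GRing.Theory Num.Theory numFieldNormedType.Exports.
Import Normc HBSimple HBNNSimple.

Local Open Scope classical_set_scope.
Local Open Scope ring_scope.
Local Open Scope complex_scope.

(** * Convexity of power sums on a product of simplices *)

Lemma powR_convex_bound (R : realType) (q r b c : R) :
  1 <= q -> 0 <= r -> 0 <= b -> 0 <= c <= 1 ->
  (r + c * b) `^ q <= r `^ q + c * ((r + b) `^ q - r `^ q).
Proof.
move=> q1 r0 b0 /andP[c0 c1].
have /= := @convex_powR R q q1 (Itv01 c0 c1) (r + b) r.
rewrite !inE /= !in_itv /= !andbT addr_ge0// r0 => /(_ isT isT).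
rewrite !convRE /= => h.
have -> : r + c * b = c * (r + b) + (1 - c) * r by ring.
by apply: (le_trans h); rewrite le_eqVlt; apply/orP; left;
  apply/eqP; rewrite /unstable.onem; ring.
Qed.

(** The chord bound replaces the sum by an affine function of [c] with slopes [D i >= 0]. As the
    [c i] sum to at most [1], the largest slope bounds it, and at the corresponding vertex the chord
    bound is an equality. *)
Lemma simplex_vertex1 (R : realType) (q : R) n (r b c : 'I_n -> R) :
  1 <= q -> (0 < n)%N -> (forall i, 0 <= r i) -> (forall i, 0 <= b i) ->
  (forall i, 0 <= c i) -> \sum_i c i <= 1 ->
  exists i0, \sum_i (r i + c i * b i) `^ q <=
             \sum_i (r i + (i == i0)%:R * b i) `^ q.
Proof.
move=> q1 n0 r0 b0 c0 cs.
pose D i := (r i + b i) `^ q - r i `^ q.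
have q0 : 0 <= q by rewrite (le_trans ler01).
have D0 i : 0 <= D i.
  by rewrite subr_ge0 ge0_ler_powR// ?nnegrE ?addr_ge0// lerDl.
have [i0 _ Dmax] := @Order.TotalTheory.arg_maxP _ _ _ (Ordinal n0) xpredT D isT.
exists i0.
have c1 i : c i <= 1.
  by apply: le_trans cs; rewrite (bigD1 i)//= lerDl sumr_ge0.
have h : \sum_i (r i + c i * b i) `^ q <= \sum_i (r i `^ q + c i * D i).
  by apply: ler_sum => i _; apply: powR_convex_bound => //; rewrite c0 c1.
apply: (le_trans h).
have -> : \sum_i (r i + (i == i0)%:R * b i) `^ q = \sum_i r i `^ q + D i0.
  rewrite (bigD1 i0)//= eqxx mul1r [in RHS](bigD1 i0)//= /D.
  rewrite (eq_bigr (fun i => r i `^ q)); last first.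
    by move=> i /negbTE ->; rewrite mul0r addr0.
  ring.
rewrite big_split /= lerD2l.
apply: (@le_trans _ _ (\sum_i c i * D i0)).
  by apply: ler_sum => i _; rewrite ler_wpM2l//; exact: Dmax.
by rewrite -mulr_suml ler_piMl.
Qed.

(* [phi] encodes a vertex of the product of simplices containing [c]; it is
   chosen one factor at a time. *)
Lemma simplex_vertex (R : realType) (q : R) n (K : eqType)
    (b c : 'I_n -> K -> R) :
  1 <= q -> (0 < n)%N -> (forall i k, 0 <= b i k) -> (forall i k, 0 <= c i k) ->
  (forall k, \sum_i c i k <= 1) ->
  forall (s : seq K) (r : 'I_n -> R), uniq s -> (forall i, 0 <= r i) ->
  exists phi : K -> 'I_n,
    \sum_i (r i + \sum_(k <- s) c i k * b i k) `^ q <=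
    \sum_i (r i + \sum_(k <- s | phi k == i) b i k) `^ q.
Proof.
move=> q1 n0 b0 c0 c1; elim=> [|k s IH] r /=.
  by move=> _ r0; exists (fun=> Ordinal n0); under eq_bigr do rewrite big_nil;
    under [X in _ <= X]eq_bigr do rewrite big_nil.
move=> /andP[ks us] r0.
(* With the sum over [s] absorbed into the offset, the factor at [k] moves to a vertex; its
   contribution then joins the offset to which the induction hypothesis applies. *)
have [|i0 hi0] := @simplex_vertex1 R q n
    (fun i => r i + \sum_(k <- s) c i k * b i k)
    (b^~ k) (c^~ k) q1 n0 _ (b0^~ k) (c0^~ k) (c1 k).
  by move=> i; rewrite addr_ge0// sumr_ge0// => j _; rewrite mulr_ge0.
have [|phi hphi] := IH (fun i => r i + (i == i0)%:R * b i k) us.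
  by move=> i; rewrite addr_ge0// mulr_ge0.
exists (fun k' => if k' == k then i0 else phi k').
under eq_bigr do rewrite big_cons addrCA addrC.
apply: (le_trans hi0) => /=; under [X in X <= _]eq_bigr do rewrite addrAC.
apply: (le_trans hphi); rewrite le_eqVlt; apply/orP; left; apply/eqP.
apply: eq_bigr => i _; congr (_ `^ _); rewrite big_cons eqxx eq_sym.
(* Since [k] does not occur in [s], redefining [phi] at [k] leaves the sum over [s] unchanged. *)
have -> : \sum_(j <- s | (if j == k then i0 else phi j) == i) b i j
        = \sum_(j <- s | phi j == i) b i j.
  rewrite big_seq_cond [RHS]big_seq_cond; apply: eq_bigl => j.
  by case: (eqVneq j k) => // ->; rewrite (negbTE ks).
by case: ifP => _; rewrite ?mul1r ?mul0r ?addr0 // addrA.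
Qed.

(** * Dominated simple approximation and finite sums of integrals *)

(** The positive and negative parts of [g] are each approximated from below by an increasing
    sequence. At every point one of the two parts vanishes, so the difference of the approximations
    stays bounded by [|g|]. *)
Lemma sfun_approx_dominated d (T : measurableType d) (R : realType)
    (g : T -> R) :
  measurable_fun setT g ->
  exists s : {sfun T >-> R}^nat,
    (forall m x, `|s m x| <= `|g x|) /\ (forall x, s m x @[m --> \oo] --> g x).
Proof.
move=> mg.
have key (h : T -> R) (mh : measurable_fun setT (EFin \o h)) :
    (forall x, 0 <= h x) ->
    let a := nnsfun_approx measurableT mh in
    (forall x, a m x @[m --> \oo] --> h x) /\
    (forall m x, 0 <= a m x <= h x).
  move=> h0 a.
  have ac x : a m x @[m --> \oo] --> h x.
    have /fine_cvgP[_] := @cvg_nnsfun_approx _ _ _ _ measurableT _ mh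
      (fun x _ => h0 x) x Logic.I.
    exact.
  split=> // m x; rewrite fun_ge0 /= -(cvg_lim _ (ac x))//.
  apply: (nondecreasing_cvgn_le _ _ m) => //; last by apply/cvg_ex; exists (h x).
  by move=> i j ij; exact/lefP/(nd_nnsfun_approx measurableT mh).
have mp : measurable_fun setT (EFin \o g^\+%R).
  by apply/measurable_EFinP; exact: measurable_funrpos.
have mn : measurable_fun setT (EFin \o g^\-%R).
  by apply/measurable_EFinP; exact: measurable_funrneg.
have [pc pb] := key _ mp (fun x => funrpos_ge0 g x).
have [nc nb] := key _ mn (fun x => funrneg_ge0 g x).
exists (fun m => (nnsfun_approx measurableT mp m : {sfun T >-> R})
                 - (nnsfun_approx measurableT mn m : {sfun T >-> R})).
split=> [m x|x].
  rewrite sfunB; change (`|nnsfun_approx measurableT mp m x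
                           - nnsfun_approx measurableT mn m x| <= `|g x|).
  move: (pb m x) (nb m x); rewrite /funrpos /funrneg.
  move: (nnsfun_approx _ _ _ _) (nnsfun_approx _ _ _ _) => p n.
  move=> /andP[p0 p1] /andP[n0 n1].
  case: (ger0P (g x)) => gx.
    rewrite max_l// in p1; rewrite max_r ?oppr_le0// in n1.
    by rewrite ler_norml; apply/andP; split; lra.
  rewrite max_r ?(ltW gx)// in p1; rewrite max_l ?oppr_ge0 ?(ltW gx)// in n1.
  by rewrite ler_norml; apply/andP; split; lra.
rewrite [X in _ --> X](_ : _ = g^\+ x - g^\- x); last first.
  by rewrite -[in LHS](funrposBneg g).
by under eq_fun do rewrite sfunB /=; apply: cvgB.
Qed.

Lemma Rintegral_sum d (T : measurableType d) (R : realType)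
    (mu : {measure set T -> \bar R}) (I : Type) (s : seq I) (P : pred I)
    (h : I -> T -> R) :
  (forall i, mu.-integrable setT (EFin \o h i)) ->
  \int[mu]_x (\sum_(i <- s | P i) h i x) = \sum_(i <- s | P i) \int[mu]_x h i x.
Proof.
move=> hi; rewrite /Rintegral; under eq_integral do rewrite -sumEFin.
rewrite (integral_sum measurableT hi) -sum_fine// => i _.
exact: (integrable_fin_num measurableT (hi i)).
Qed.

(** * Step functions in $L^1$ and the upper bound for the (1,q)-multi-norm *)

Section step_functions.
Context d (T : measurableType d) (R : realType) (mu : {measure set T -> \bar R}).
Local Notation cls := (\pi_(cL1 mu)%qT).

Lemma cls_sum (I : Type) (s : seq I) (a : I -> R[i]) (e : I -> cL1fun mu) :
  cls (\sum_(k <- s) a k *: e k) = \sum_(k <- s) a k *: cls (e k).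
Proof.
elim: s => [|k s IH]; first by rewrite !big_nil.
rewrite !big_cons -IH.
rewrite [RHS](_ : _ = cL1_add (cL1_scale (a k) (cls (e k)))
  (cls (\sum_(j <- s) a j *: e j)))//.
by rewrite cL1_piZ cL1_piD.
Qed.

Lemma cL1fun_sumE (I : Type) (s : seq I) (P : pred I) (e : I -> cL1fun mu) x :
  (\sum_(k <- s | P k) e k : cL1fun mu) x = \sum_(k <- s | P k) e k x.
Proof. by apply: (big_morph (fun u : cL1fun mu => u x)). Qed.

(** Homogeneity extends the bound from the unit ball: a nonzero [u] is rescaled to norm [1]. *)
Lemma weak_1_summing_norm_le1 n (lam : 'I_n -> dual (cL1 mu)) :
  (weak_1_summing_norm lam <= 1)%E ->
  forall u, \sum_j normc (lam j u) <= cL1_norm u.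
Proof.
move=> lam1 u; set r := cL1_norm u.
have r0 : 0 <= r by apply: Rintegral_ge0 => x _; exact: normc_ge0.
have [u0|u0] := eqVneq u 0.
  by rewrite u0 big1// => j _; rewrite linear0 normc0.
have rn : r != 0.
  apply: contra u0 => /eqP re0; rewrite -normr_eq0 cL1_normE.
  by rewrite -[X in X%:C]/r re0.
have : \sum_j normc (lam j ((r^-1)%:C *: u)) <= 1.
  rewrite -lee_fin; apply: le_trans lam1; apply: ereal_sup_ubound.
  exists ((r^-1)%:C *: u) => //=.
  rewrite normrZ cL1_normE -[X in _ * X%:C]/r normc_def /= expr0n /= addr0.
  by rewrite sqrtr_sqr -rmorphM /= ger0_norm ?invr_ge0// mulVf.
under eq_bigr do rewrite linearZ normcM.
rewrite -mulr_sumr /= expr0n /= addr0 sqrtr_sqr ger0_norm ?invr_ge0//.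
by rewrite mulrC ler_pdivrMr ?mul1r// lt_def rn.
Qed.

Lemma cL1fun_integrable (g : cL1fun mu) :
  mu.-integrable setT (EFin \o (fun x => normc (g x))).
Proof. exact: (cintegrable_normc (cL1funP g)). Qed.


(* Since [A] may have infinite measure, its indicator need not be integrable;
   [e := 0] works in that case, as then [s] vanishes on [A]. *)
Lemma cL1fun_unit (A : set T) : measurable A ->
  exists e : cL1fun mu, forall (s : cL1fun mu) a,
    (forall x, A x -> s x = a) -> forall x, a * e x = (x \in A)%:R * s x.
Proof.
move=> mA; pose g x : R[i] := (x \in A)%:R.
have gE x : g x = (\1_A x)%:C by rewrite /g indicE; case: (x \in A).
have [ig|nig] := pselect (cintegrable mu g).
  have gin : g \in cL1fun_pred mu by rewrite inE.
  exists (CL1fun gin) => s a sa x /=; rewrite mulrC /g.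
  by case: (boolP (x \in A)) => [/set_mem/sa ->|]; rewrite ?mul0r.
exists 0 => s a sa x; rewrite mulr0; apply/esym.
have [/set_mem xA|] := boolP (x \in A); last by rewrite mul0r.
have [->|a0] := eqVneq (s x) 0; first by rewrite mulr0.
exfalso; apply: nig.
have na0 : normc (s x) != 0 by apply: contra a0 => /eqP/eq0_normc ->.
have gn y : normc (g y) = \1_A y.
  by rewrite gE /= expr0n /= addr0 sqrtr_sqr ger0_norm.
split.
- under eq_fun do rewrite gE /=; exact: measurable_indic.
- by under eq_fun do rewrite gE /=; exact: measurable_cst.
have := integrableZl measurableT (normc (s x))^-1 (cL1fun_integrable s).
move=> /integrableP[_]; apply: le_lt_trans; apply: ge0_le_integral => //.
- by move=> y _; rewrite lee_fin normc_ge0.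
- by under eq_fun do rewrite gn; apply/measurable_EFinP; exact: measurable_indic.
- apply: measurableT_comp => //; apply/measurable_EFinP.
  apply: measurable_funM => //; apply: measurable_normc;
    by have [] := cL1funP s.
move=> y _; rewrite gn indicE.
have [/set_mem yA|_] := boolP (y \in A); last by rewrite abse_ge0.
by rewrite /= (sa y yA) -(sa x xA) mulVf// normr1.
Qed.

(** The finite-valued label [kappa] encodes a measurable partition on whose cells all the [s i] are
    constant at once. Sharing the cells is what lets a vertex of the product of simplices be read as
    one ordered partition. *)
Lemma step_functions_bound (q : R) n (lam : 'I_n -> dual (cL1 mu))
    (f s : 'I_n -> cL1fun mu) (K : finType) (kappa : T -> K)
    (a : 'I_n -> K -> R[i]) :
  1 <= q -> (0 < n)%N -> (weak_1_summing_norm lam <= 1)%E ->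
  (forall k, measurable (kappa @^-1` [set k])) ->
  (forall i x, s i x = a i (kappa x)) ->
  (forall i x, normc (s i x) <= normc (f i x)) ->
  exists2 X, ordered_partition X &
    \sum_i normc (lam i (cls (s i))) `^ q <=
    \sum_i (\int[mu]_(x in X i) normc (f i x)) `^ q.
Proof.
move=> q1 n0 lam1 mk sE sf.
have q0 : 0 <= q by rewrite (le_trans ler01).
pose A k := kappa @^-1` [set k].
have inA k x : (x \in A k) = (kappa x == k).
  by apply/idP/eqP => [/set_mem//|kx]; apply/mem_set.
pose e k := projT1 (cid (cL1fun_unit (mk k))).
have eE i k x : a i k * e k x = (kappa x == k)%:R * s i x.
  rewrite -inA; apply: (projT2 (cid (cL1fun_unit (mk k)))) => y.
  by rewrite sE => ->.
have sumE i : s i = \sum_(k <- enum K) a i k *: e k.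
  apply/val_inj/funext => x /=; rewrite cL1fun_sumE big_enum /=.
  transitivity (\sum_k a i k * e k x) => //.
  under eq_bigr do rewrite eE.
  rewrite (bigD1 (kappa x))//= eqxx mul1r big1 ?addr0// => k.
  by rewrite eq_sym => /negbTE ->; rewrite mul0r.
pose m k := cL1_norm (cls (e k)).
have m0 k : 0 <= m k by apply: Rintegral_ge0 => x _; exact: normc_ge0.
pose c i k := normc (lam i (cls (e k))) / m k.
pose b i k := normc (a i k) * m k.
have c0 i k : 0 <= c i k by rewrite divr_ge0 ?normc_ge0.
have b0 i k : 0 <= b i k by rewrite mulr_ge0 ?normc_ge0.
have lame k : \sum_i normc (lam i (cls (e k))) <= m k.
  exact: weak_1_summing_norm_le1.
have c1 k : \sum_i c i k <= 1.
  rewrite -mulr_suml; have [->|mk0] := eqVneq (m k) 0.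
    by rewrite invr0 mulr0 ler01.
  by rewrite ler_pdivrMr ?mul1r// lt_def mk0 m0.
(* If [m k = 0], the quotient [c i k] is [0] by convention; [lame] then forces the left side to
   vanish too. *)
have cm i k : normc (lam i (cls (e k))) = c i k * m k.
  have [mk0|mk0] := eqVneq (m k) 0; last by rewrite divfK.
  rewrite mk0 mulr0; apply/eqP; rewrite eq_le normc_ge0 andbT -mk0.
  apply: le_trans (lame k); rewrite (bigD1 i)//= lerDl sumr_ge0// => j _.
  exact: normc_ge0.
have [phi] := simplex_vertex q1 n0 b0 c0 c1 (enum_uniq K)
  (fun i : 'I_n => lexx (0 : R)).
under eq_bigr do rewrite add0r.
under [X in _ <= X]eq_bigr do rewrite add0r.
(* [X i] is the union of the cells that the vertex [phi] assigns to [i]. *)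
move=> hphi; pose X i := [set x | phi (kappa x) = i].
have mX i : measurable (X i).
  rewrite (_ : X i = \bigcup_(k in [set k | phi k = i]) A k).
    by apply: fin_bigcup_measurable => [|k _]; [exact: finite_finset|exact: mk].
  apply/seteqP; split => [x xi|x [k /= ki kx]]; first by exists (kappa x).
  by rewrite /X /= kx.
exists X.
  split => //; first by move=> i j _ _ [x [<- <-]].
  by apply/seteqP; split => // x _; exists (phi (kappa x)).
(* Two comparisons remain, one on each side of [hphi]: [|lam i (s i)|] against the sum of the
   [c i k * b i k], and the sum of the [b i k] over cells assigned to [i] against the integral of
   [|f i|] over [X i]. *)
apply: (le_trans (le_trans _ hphi)).
  apply: ler_sum => i _; apply: ge0_ler_powR; rewrite ?nnegrE ?normc_ge0//.
    by rewrite sumr_ge0// => k _; rewrite mulr_ge0.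
  rewrite sumE cls_sum linear_sum.
  apply: (@le_trans _ _ (\sum_(k <- enum K) normc (lam i (a i k *: cls (e k))))).
    elim: (enum K) => [|k t IH]; first by rewrite !big_nil normc0.
    by rewrite !big_cons (le_trans (ler_normcD _ _))// lerD2l.
  apply: ler_sum => k _; rewrite linearZ normcM cm /b.
  by rewrite mulrCA.
apply: ler_sum => i _; apply: ge0_ler_powR; rewrite ?nnegrE//.
- by rewrite sumr_ge0.
- by apply: Rintegral_ge0 => x _; exact: normc_ge0.
have ie k :
    mu.-integrable setT (EFin \o (fun x => normc (a i k) * normc (e k x))).
  exact: integrableZl (cL1fun_integrable (e k)).
rewrite (eq_bigr (fun k => \int[mu]_x (normc (a i k) * normc (e k x))));
  last first.
  by move=> k _; rewrite RintegralZl//; [rewrite /b /m cL1_norm_pi|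
    exact: cL1fun_integrable].
rewrite -Rintegral_sum// [X in _ <= X]Rintegral_mkcond.
apply: le_Rintegral => //.
- apply: (eq_integrable measurableT (fun x =>
    (\sum_(k <- enum K | phi k == i) (normc (a i k) * normc (e k x))%:E)%E)).
    by move=> x _ /=; rewrite sumEFin.
  by apply: integrable_sum => // k _; exact: ie.
- rewrite -restrict_EFin -integrable_mkcond//.
  by apply: integrableS (cL1fun_integrable (f i)).
(* Pointwise, only the cell [k = kappa x] can contribute. It is counted exactly when [x] lies in
   [X i], and then gives [|s i x| <= |f i x|]. *)
move=> x _; under eq_bigr do rewrite -normcM eE normcM.
have [xi|xi] := eqVneq (phi (kappa x)) i; last first.
  rewrite big1_seq ?patchE.
    by case: ifPn; rewrite ?normc_ge0.
  move=> k /andP[/eqP ki _]; case: eqVneq => [kk|_]; rewrite ?normc0 ?mul0r//.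
  by move: xi; rewrite kk ki eqxx.
rewrite patchE mem_set// big_enum_cond /= (bigD1 (kappa x)) /=; last exact/eqP.
rewrite eqxx normc1 mul1r big1 ?addr0// => k /andP[_].
by rewrite eq_sym => /negbTE ->; rewrite normc0 mul0r.
Qed.


(** One dominated simple approximation [Q] of the identity of the real line, composed with the real
    and imaginary parts, serves all the [f i]. Dominated convergence with bound [2 |f i|] gives
    convergence in norm, and finitely many indices admit a common [m]. *)
Lemma step_functions_approx n (f : 'I_n -> cL1fun mu) (eps : R) : 0 < eps ->
  exists (K : finType) (kappa : T -> K) (a : 'I_n -> K -> R[i])
    (s : 'I_n -> cL1fun mu),
  [/\ forall k, measurable (kappa @^-1` [set k]),
      forall i x, s i x = a i (kappa x),
      forall i x, normc (s i x) <= normc (f i x) &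
      forall i, \int[mu]_x normc ((f i - s i) x) <= eps].
Proof.
move=> eps0.
have [Q [Qle Qcvg]] :=
  @sfun_approx_dominated _ R R id (@measurable_id _ R setT).
have mQ m : measurable_fun setT (Q m) by [].
have mRe i : measurable_fun setT (fun x => complex.Re (f i x)).
  by have [] := cL1funP (f i).
have mIm i : measurable_fun setT (fun x => complex.Im (f i x)).
  by have [] := cL1funP (f i).
pose S m i x : R[i] := Q m (complex.Re (f i x)) +i* Q m (complex.Im (f i x)).
have mSRe m i : measurable_fun setT (fun x => complex.Re (S m i x)).
  exact: measurableT_comp.
have mSIm m i : measurable_fun setT (fun x => complex.Im (S m i x)).
  exact: measurableT_comp.
have Sle m i x : normc (S m i x) <= normc (f i x).
  rewrite [X in _ <= X]normc_sqrtE /= ler_sqrt ?addr_ge0 ?sqr_ge0//.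
  have sq t : Q m t ^+ 2 <= t ^+ 2.
    rewrite -(real_normK (num_real (Q m t))) -(real_normK (num_real t)).
    by rewrite lerXn2r ?nnegrE//; exact: Qle.
  by apply: lerD; exact: sq.
have Sint m i : S m i \in cL1fun_pred mu.
  rewrite inE; split => //.
  have [_ _] := cL1funP (f i); apply: le_lt_trans; apply: ge0_le_integral => //.
  - by move=> x _; rewrite lee_fin normc_ge0.
  - by apply/measurable_EFinP; exact: measurable_normc.
  - by apply/measurable_EFinP; exact: measurable_normc.
  - by move=> x _; rewrite lee_fin.
pose s m i : cL1fun mu := CL1fun (Sint m i).
have scvg i x : normc ((f i - s m i) x) @[m --> \oo] --> (0 : R).
  have Qsub t : (t - Q m t) ^+ 2 @[m --> \oo] --> (0 : R).
    have Q0 : t - Q m t @[m --> \oo] --> (0 : R).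
      by rewrite -(subrr t); apply: cvgB => //; exact: cvg_cst.
    rewrite -(mul0r (0 : R)); apply: cvg_trans (cvgM Q0 Q0).
    by under eq_fun do rewrite expr2.
  rewrite (_ : (fun _ => _) = (fun m => Num.sqrt
     ((complex.Re (f i x) - Q m (complex.Re (f i x))) ^+ 2 +
      (complex.Im (f i x) - Q m (complex.Im (f i x))) ^+ 2))); last first.
    apply/funext => m; rewrite normc_sqrtE.
    rewrite [(f i - s m i) x](_ : _ = f i x - S m i x)// /S.
    by case: (f i x).
  rewrite -(@sqrtr0 R) -(addr0 (0 : R)).
  by apply: continuous_cvg; [exact: sqrt_continuous|exact: cvgD].
have intcvg i : \int[mu]_x normc ((f i - s m i) x) @[m --> \oo] --> (0 : R).
  have [] := @dominated_convergence _ T R mu setT measurableT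
    (fun m x => (normc ((f i - s m i) x))%:E) (cst 0%E)
    (fun x => (2 * normc (f i x))%:E).
  - by move=> m; exact: measurable_int (cL1fun_integrable (f i - s m i)).
  - exact: measurable_cst.
  - by apply: aeW => x _; apply: cvg_EFin; [exact: nearW|exact: scvg].
  - exact: integrableZl (cL1fun_integrable (f i)).
  - apply: aeW => x m _; rewrite gee0_abs ?lee_fin ?normc_ge0//.
    rewrite (le_trans (ler_normcD _ _))// mulr2n mulrDl mul1r lerD2l.
    by rewrite normcN; exact: Sle.
  by move=> _ _; rewrite integral0 => /fine_cvgP[].
have [m sm] : exists m, forall i, \int[mu]_x normc ((f i - s m i) x) <= eps.
  have : \forall m \near \oo, forall i,
      \int[mu]_x normc ((f i - s m i) x) <= eps.
    apply: filter_forall => i.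
    have /cvgrPdist_le/(_ _ eps0) := intcvg i; apply: filterS => m.
    by rewrite sub0r normrN; apply: le_trans; exact: ler_norm.
  by move=> [N _ /(_ N (leqnn N))]; exists N.
(* The label of [x] records the real and imaginary parts of every [s m i x], all lying in the finite
   range [V] of [Q m]. *)
pose V := fset_set (range (Q m)).
have QV t : Q m t \in V by rewrite in_fset_set// mem_set//; exists t.
pose kappa x := [ffun i => ([` QV (complex.Re (f i x))],
                            [` QV (complex.Im (f i x))])]%fset.
exists {ffun 'I_n -> V * V}%type, kappa.
exists (fun i (k : {ffun _}) => val (k i).1 +i* val (k i).2), (s m); split => //.
- move=> k; rewrite (_ : _ @^-1` _ = \bigcap_(i in [set: 'I_n])
      ([set x | complex.Re (S m i x) = val (k i).1] `&`
       [set x | complex.Im (S m i x) = val (k i).2])).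
    apply: fin_bigcap_measurable => [|i _]; first exact: finite_finset.
    apply: measurableI.
      by have := mSRe m i measurableT _ (measurable_set1 (val (k i).1));
        rewrite setTI.
    by have := mSIm m i measurableT _ (measurable_set1 (val (k i).2));
      rewrite setTI.
  apply/seteqP; split => x /=.
    by move=> <- i _; rewrite !ffunE.
  move=> h; apply/ffunP => i; have [/= h1 h2] := h i Logic.I.
  by rewrite ffunE; case: (k i) h1 h2 => u v /= h1 h2; congr (_, _);
    apply: val_inj.
- by move=> i x; rewrite !ffunE.
- exact: Sle.
Qed.


Lemma multi_norm_1q_le (q : R) n (f : 'I_n -> cL1 mu) : 1 <= q -> (0 < n)%N ->
  (multi_norm_1q q f <= standard_multi_norm q f)%E.
Proof.
move=> q1 n0; have q0 : 0 < q by rewrite (lt_le_trans ltr01).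
apply: ge_ereal_sup => _ [lam /= lam1 <-].
(* It suffices to bound [t] times the value for every [0 < t < 1]. The approximation error thus
   becomes a factor, which passes through the powers by homogeneity. *)
apply/lee_mul01Pr; first by rewrite lee_fin powR_ge0.
move=> t /andP[t0 t1]; rewrite -EFinM.
pose y i := normc (lam i (f i)).
have y0 i : 0 <= y i by exact: normc_ge0.
(* An error of at most [(1 - t) * y i] still leaves [t * y i]. Indices with [y i = 0] impose no
   constraint, and omitting them keeps [eps] positive. *)
pose eps := \big[Order.min/1]_(i | y i != 0) ((1 - t) * y i).
have eps0 : 0 < eps.
  by apply: lt_bigmin => // i yi; rewrite mulr_gt0 ?subr_gt0// lt_def yi y0.
have [K [kappa [a [s [mk sE sf fs]]]]] :=
  step_functions_approx (fun i => repr (f i)) eps0.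
have [X pX hX] := step_functions_bound q1 n0 lam1 mk sE sf.
have ty i : t * y i <= normc (lam i (cls (s i))).
  have [yi0|yi] := eqVneq (y i) 0; first by rewrite yi0 mulr0 normc_ge0.
  have e1 : eps <= (1 - t) * y i by exact: bigmin_le_cond.
  have e2 : normc (lam i (f i - cls (s i))) <= eps.
    apply: le_trans (fs i); rewrite -cL1_norm_pi.
    have -> : f i - cls (s i) = cls (repr (f i) - s i).
      rewrite -[in LHS](reprK (f i)).
      rewrite [LHS](_ : _ = cL1_add (cls (repr (f i))) (cL1_opp (cls (s i))))//.
      by rewrite cL1_piN cL1_piD.
    apply: le_trans (weak_1_summing_norm_le1 lam1 _).
    by rewrite (bigD1 i)//= lerDl sumr_ge0// => j _; exact: normc_ge0.
  have e3 : y i <= normc (lam i (f i - cls (s i))) + normc (lam i (cls (s i))).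
    by apply: le_trans (ler_normcD _ _); rewrite -linearD subrK.
  by move: e1 e2 e3; set A := normc _; set B := normc _; lra.
apply: (@le_trans _ _ ((\sum_i (\int[mu]_(x in X i) normc (repr (f i) x)) `^ q)
                        `^ q^-1)%:E); last first.
  by apply: ereal_sup_ubound; exists X.
rewrite lee_fin.
have -> : t * (\sum_i normc (lam i (f i)) `^ q) `^ q^-1
        = (\sum_i (t * y i) `^ q) `^ q^-1.
  under [X in _ = X `^ _]eq_bigr do rewrite powRM ?(ltW t0)//.
  rewrite -mulr_sumr powRM ?powR_ge0 ?sumr_ge0// => [|i _]; last exact: powR_ge0.
  by rewrite -powRrM mulfV ?gt_eqF// powRr1// ltW.
have sum0 (z : 'I_n -> R) : \sum_i z i `^ q \is Num.nneg.
  by rewrite nnegrE sumr_ge0// => i _; exact: powR_ge0.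
apply: ge0_ler_powR => //; first by rewrite invr_ge0 ltW.
apply: le_trans hX; apply: ler_sum => i _.
apply: ge0_ler_powR; rewrite ?nnegrE ?normc_ge0// ?mulr_ge0// ltW//.
Qed.

End step_functions.

(** * Functionals on $L^1$ given by bounded measurable functions *)

Lemma ReM (R : realType) (z u : R[i]) : complex.Re (z * u) =
  complex.Re z * complex.Re u - complex.Im z * complex.Im u.
Proof. by case: z u => [? ?] []. Qed.

Lemma ImM (R : realType) (z u : R[i]) : complex.Im (z * u) =
  complex.Re z * complex.Im u + complex.Im z * complex.Re u.
Proof. by case: z u => [? ?] []. Qed.

Section pairing.
Context d (T : measurableType d) (R : realType) (mu : {measure set T -> \bar R}).
Local Notation cls := (\pi_(cL1 mu)%qT).
Variable w : T -> R[i].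
Hypothesis mwRe : measurable_fun setT (fun x => complex.Re (w x)).
Hypothesis mwIm : measurable_fun setT (fun x => complex.Im (w x)).
Hypothesis w1 : forall x, normc (w x) <= 1.

Lemma cintegrableM (g : cL1fun mu) : (fun x => w x * g x) \in cL1fun_pred mu.
Proof.
have [gRe gIm gi] := cL1funP g.
have mRe : measurable_fun setT (fun x => complex.Re (w x * g x)).
  by under eq_fun do rewrite ReM; apply: measurable_funB; exact: measurable_funM.
have mIm : measurable_fun setT (fun x => complex.Im (w x * g x)).
  by under eq_fun do rewrite ImM; apply: measurable_funD; exact: measurable_funM.
rewrite inE; split => //; apply: le_lt_trans gi; apply: ge0_le_integral => //.
- by move=> x _; rewrite lee_fin normc_ge0.
- by apply/measurable_EFinP; exact: measurable_normc.
- by apply/measurable_EFinP; exact: measurable_normc.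
- by move=> x _; rewrite lee_fin normcM ler_piMl// normc_ge0.
Qed.

Lemma cL1fun_integrable_Re (g : cL1fun mu) :
  mu.-integrable setT (EFin \o (fun x => complex.Re (g x))).
Proof.
have [gRe gIm _] := cL1funP g.
apply: le_integrable (cL1fun_integrable g) => //.
  exact/measurable_EFinP.
move=> x _; rewrite /= lee_fin [leRHS]ger0_norm ?normc_ge0// normc_sqrtE.
by rewrite -sqrtr_sqr ler_sqrt ?addr_ge0 ?sqr_ge0// lerDl sqr_ge0.
Qed.

Lemma cL1fun_integrable_Im (g : cL1fun mu) :
  mu.-integrable setT (EFin \o (fun x => complex.Im (g x))).
Proof.
have [gRe gIm _] := cL1funP g.
apply: le_integrable (cL1fun_integrable g) => //.
  exact/measurable_EFinP.
move=> x _; rewrite /= lee_fin [leRHS]ger0_norm ?normc_ge0// normc_sqrtE.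
by rewrite -sqrtr_sqr ler_sqrt ?addr_ge0 ?sqr_ge0// lerDr sqr_ge0.
Qed.

Definition cintegral (g : T -> R[i]) : R[i] :=
  (\int[mu]_x complex.Re (g x)) +i* (\int[mu]_x complex.Im (g x)).

Lemma ae_eq_cintegral (f g : cL1fun mu) :
  {ae mu, forall x, f x = g x} -> cintegral f = cintegral g.
Proof.
move=> fg; have [fRe fIm _] := cL1funP f; have [gRe gIm _] := cL1funP g.
rewrite /cintegral /Rintegral; congr (fine _ +i* fine _);
  apply: ae_eq_integral => //; (try exact/measurable_EFinP);
  by apply: filterS fg => x /= -> _.
Qed.

Lemma cintegral_linear (a : R[i]) (f g : cL1fun mu) :
  cintegral (a *: f + g) = a * cintegral f + cintegral g.
Proof.
have fRe := cL1fun_integrable_Re f; have fIm := cL1fun_integrable_Im f.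
have gRe := cL1fun_integrable_Re g; have gIm := cL1fun_integrable_Im g.
have Z k (h : T -> R) : mu.-integrable setT (EFin \o h) ->
  mu.-integrable setT (EFin \o (fun x => k * h x))
  by move/(integrableZl measurableT k).
apply/eqP; rewrite eq_complex /cintegral !raddfD /= ReM ImM /=.
apply/andP; split; apply/eqP.
  rewrite (_ : (fun x => _) =
    (fun x => complex.Re (a * f x + g x)))//.
  under eq_Rintegral do rewrite raddfD /= ReM.
  rewrite RintegralD//; last first.
    exact: (integrableB measurableT (Z _ _ fRe) (Z _ _ fIm)).
  rewrite RintegralB//; [|exact: Z..].
  by rewrite !RintegralZl.
rewrite (_ : (fun x => _) = (fun x => complex.Im (a * f x + g x)))//.
under eq_Rintegral do rewrite raddfD /= ImM.
rewrite RintegralD//; last first.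
  exact: (integrableD measurableT (Z _ _ fIm) (Z _ _ fRe)).
rewrite RintegralD//; [|exact: Z..].
by rewrite !RintegralZl.
Qed.

(* Cauchy-Schwarz in the plane, applied to the vector [cintegral g] and to each
   value of [g], avoids polar decompositions. *)
Lemma normc_cintegral_le (g : cL1fun mu) :
  normc (cintegral g) <= \int[mu]_x normc (g x).
Proof.
have gRe := cL1fun_integrable_Re g; have gIm := cL1fun_integrable_Im g.
have Z k (h : T -> R) : mu.-integrable setT (EFin \o h) ->
  mu.-integrable setT (EFin \o (fun x => k * h x))
  by move/(integrableZl measurableT k).
have [->|I0] := eqVneq (normc (cintegral g)) 0.
  by apply: Rintegral_ge0 => x _; exact: normc_ge0.
have Ipos : 0 < normc (cintegral g) by rewrite lt_def I0 normc_ge0.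
set p := \int[mu]_x complex.Re (g x); set s := \int[mu]_x complex.Im (g x).
set r := normc (cintegral g) in Ipos *.
have r2 : r ^+ 2 = p ^+ 2 + s ^+ 2 by rewrite sqr_sqrtr ?addr_ge0 ?sqr_ge0.
(* After clearing [r^-1], the left side is the integral of [p * Re g + s * Im g], to be bounded
   pointwise by [r * |g|]. *)
have -> : r = r^-1 * (p * p + s * s).
  by rewrite -!expr2 -r2 expr2 mulKf// gt_eqF.
rewrite ler_pdivrMl// -!RintegralZl//; last exact: cL1fun_integrable.
rewrite -RintegralD//; [|exact: Z..].
apply: le_Rintegral => //.
- exact: (integrableD measurableT (Z _ _ gRe) (Z _ _ gIm)).
- exact: Z (cL1fun_integrable g).
move=> x _; rewrite -(ger0_norm (ltW Ipos)) -sqrtr_sqr r2 normc_sqrtE.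
move: p s {r r2 Ipos I0} => p s; case: (g x) => u v /=.
rewrite -sqrtrM ?addr_ge0 ?sqr_ge0//; apply: le_trans (ler_norm _) _.
rewrite -sqrtr_sqr ler_sqrt ?mulr_ge0 ?addr_ge0 ?sqr_ge0//.
(* Lagrange's identity gives the deficit in the Cauchy-Schwarz inequality as a square. *)
rewrite -subr_ge0 [leRHS](_ : _ = (p * v - s * u) ^+ 2) ?sqr_ge0//.
by ring.
Qed.

Definition pairing (u : cL1 mu) : R[i]^o :=
  cintegral (CL1fun (cintegrableM (repr u))).

(** Independence of the representative, from which linearity on classes follows. *)
Lemma pairing_pi (g : cL1fun mu) :
  pairing (cls g) = cintegral (CL1fun (cintegrableM g)).
Proof.
apply: ae_eq_cintegral; have := cL1_pi_repr g.
by apply: filterS => x /= e; congr (_ * _).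
Qed.

Lemma pairing_linear : linear pairing.
Proof.
move=> a; elim/cL1_ind => f; elim/cL1_ind => g.
rewrite [X in pairing X](_ : _ = cL1_add (cL1_scale a (cls f)) (cls g))//.
rewrite cL1_piZ cL1_piD !pairing_pi -[RHS]cintegral_linear.
rewrite /cintegral; congr (_ +i* _); apply: eq_Rintegral => x _ /=;
  by rewrite !fctE mulrDr [w x * (_ *: _)]mulrCA.
Qed.

HB.instance Definition _ :=
  GRing.isLinear.Build R[i] (cL1 mu) R[i]^o _ pairing pairing_linear.

(** The weight [|w|] is kept under the integral, so that the bounds for several functionals can be
    added before using that their weights sum to at most [1]. *)
Lemma normc_pairing_le (u : cL1 mu) :
  normc (pairing u) <= \int[mu]_x (normc (w x) * normc (u x)).
Proof.
apply: le_trans (normc_cintegral_le _) _.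
by under eq_Rintegral do rewrite /= normcM.
Qed.

Lemma pairing_continuous : continuous pairing.
Proof.
(* Any constant [r >= 1] bounds the functional, because [|w| <= 1]. *)
apply: bounded_linear_continuous; apply/linear_boundedP.
near=> r => u; rewrite normc_def -normc_sqrtE.
apply: (@le_trans _ _ `|u|).
  rewrite cL1_normE lecR; apply: le_trans (normc_pairing_le u) _.
  have ur := cL1fun_integrable (repr u).
  apply: le_Rintegral => //.
    have := cL1fun_integrable (CL1fun (cintegrableM (repr u))).
    by apply: eq_integrable => // x _ /=; rewrite normcM.
  by move=> x _; rewrite ler_piMl// normc_ge0.
rewrite -[leLHS]mul1r ler_wpM2r//.
Unshelve. all: by end_near. Qed.

Definition pairing_dual : dual (cL1 mu) := Dual pairing_continuous.

End pairing.

(** * Functionals attached to an ordered partition and the lower bound *)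

Section standard_le.
Context d (T : measurableType d) (R : realType) (mu : {measure set T -> \bar R}).

(* [z^* / |z|], with value [0] at [z = 0]. *)
Definition conj_phase (z : R[i]) : R[i] :=
  (complex.Re z / normc z) -i* (complex.Im z / normc z).

Lemma conj_phaseM (z : R[i]) : conj_phase z * z = (normc z)%:C.
Proof.
have [z0|z0] := eqVneq (normc z) 0.
  by rewrite (eq0_normc z0) mulr0 normc0.
have zz : normc z * normc z =
    complex.Re z * complex.Re z + complex.Im z * complex.Im z.
  by rewrite normc_sqrtE -!expr2 sqr_sqrtr ?addr_ge0 ?sqr_ge0.
apply/eqP; rewrite eq_complex ReM ImM /conj_phase; apply/andP; split; apply/eqP.
  apply: (mulIf z0); rewrite [RHS]/= zz /=; move: z0; set r := normc z => z0.
  by field.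
rewrite /=; move: z0; set r := normc z => z0.
by field.
Qed.

Lemma normc_conj_phase_le1 (z : R[i]) : normc (conj_phase z) <= 1.
Proof.
have [z0|z0] := eqVneq (normc z) 0.
  by rewrite /conj_phase z0 invr0 !mulr0 oppr0 normc0 ler01.
(* Multiplying by [|z|] reduces the claim to [conj_phaseM]. *)
rewrite -(ler_pM2r (_ : 0 < normc z)) ?lt_def ?z0 ?normc_ge0//.
by rewrite -normcM conj_phaseM mul1r normc_sqrtE /= expr0n addr0 sqrtr_sqr
  ger0_norm ?normc_ge0.
Qed.

Lemma standard_multi_norm_le (q : R) n (f : 'I_n -> cL1 mu) :
  (standard_multi_norm q f <= multi_norm_1q q f)%E.
Proof.
apply: ge_ereal_sup => _ [X [mX tX cX] <-].
pose w i x : R[i] := (\1_(X i) x)%:C * conj_phase (f i x).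
have mf i : measurable_fun setT (fun x => complex.Re (f i x)) /\
            measurable_fun setT (fun x => complex.Im (f i x)).
  by have [] := cL1funP (repr (f i)).
have mV i : measurable_fun setT (fun x => (normc (f i x))^-1).
  (* The reciprocal and the power with exponent [-1] are both [0] at [0], so they agree even where
     [f i] vanishes. *)
  under eq_fun do rewrite -powR_inv1 ?normc_ge0//.
  have [mRe mIm] := mf i.
  exact: (measurableT_comp (measurable_powR _) (measurable_normc mRe mIm)).
have wRe i x : complex.Re (w i x) =
    \1_(X i) x * (complex.Re (f i x) / normc (f i x)).
  by rewrite ReM /= mul0r subr0.
have wIm i x : complex.Im (w i x) =
    \1_(X i) x * - (complex.Im (f i x) / normc (f i x)).
  by rewrite ImM /= mul0r addr0.
have mwRe i : measurable_fun setT (fun x => complex.Re (w i x)).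
  under eq_fun do rewrite wRe.
  apply: measurable_funM; first exact: measurable_indic.
  by apply: measurable_funM => //; have [] := mf i.
have mwIm i : measurable_fun setT (fun x => complex.Im (w i x)).
  under eq_fun do rewrite wIm.
  apply: measurable_funM; first exact: measurable_indic.
  apply: measurableT_comp => //.
  by apply: measurable_funM => //; have [] := mf i.
have wle i x : normc (w i x) <= \1_(X i) x.
  rewrite normcM {1}normc_sqrtE /= expr0n addr0 sqrtr_sqr ger0_norm//.
  by rewrite ler_piMr// normc_conj_phase_le1.
have w1 i x : normc (w i x) <= 1.
  by apply: le_trans (wle i x) _; rewrite indicE lern1 leq_b1.
pose lam i := pairing_dual mu (mwRe i) (mwIm i) (w1 i).
apply: ereal_sup_ubound; exists lam; last first.
  congr ((_ `^ _)%:E); apply: eq_bigr => i _; congr (_ `^ _).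
  rewrite /lam /= /pairing /cintegral /=.
  (* The product is real and nonnegative, so the pairing has zero imaginary part and its modulus is
     the integral of [|f i|] over [X i]. *)
  have wf x : w i x * f i x = (((fun x => normc (f i x)) \_ (X i)) x)%:C.
    rewrite /w -mulrA conj_phaseM -rmorphM patchE indicE.
    by case: (x \in X i); rewrite ?mul1r ?mul0r.
  under eq_Rintegral do rewrite wf.
  under [X in _ + X ^+ 2]eq_Rintegral do rewrite wf.
  rewrite -Rintegral_mkcond /= Rintegral_cst// mul0r expr0n addr0 sqrtr_sqr.
  by rewrite ger0_norm// Rintegral_ge0// => x _; exact: normc_ge0.
(* Admissibility of [lam] comes from disjointness: at each point at most one indicator of the [X i]
   is nonzero, so the [|w i|] sum to at most [1]. *)
suff sub (u : cL1 mu) : \sum_i normc (lam i u) <= \int[mu]_x normc (u x).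
  apply: ge_ereal_sup => _ [u /= u1 <-]; rewrite lee_fin (le_trans (sub u))//.
  by move: u1; rewrite cL1_normE lecR.
have iwu i :
    mu.-integrable setT (EFin \o (fun x => normc (w i x) * normc (u x))).
  have := cL1fun_integrable
    (CL1fun (cintegrableM (mwRe i) (mwIm i) (w1 i) (repr u))).
  by apply: eq_integrable => // x _ /=; rewrite normcM.
apply: (@le_trans _ _ (\sum_i \int[mu]_x (normc (w i x) * normc (u x)))).
  by apply: ler_sum => i _; exact: normc_pairing_le.
rewrite -Rintegral_sum//; apply: le_Rintegral => //.
- apply: (eq_integrable measurableT (fun x =>
    (\sum_i (normc (w i x) * normc (u x))%:E)%E)).
    by move=> x _ /=; rewrite sumEFin.
  by apply: integrable_sum => // k _; exact: iwu.
- exact: (cL1fun_integrable (repr u)).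
move=> x _; rewrite -mulr_suml ler_piMl ?normc_ge0//.
apply: (@le_trans _ _ (\sum_i \1_(X i) x)); first exact: ler_sum.
have : (\bigcup_i X i) x by rewrite cX.
move=> [i0 _ Xi0]; rewrite (bigD1 i0)//= big1 => [|i ii0].
  by rewrite addr0 indicE lern1 leq_b1.
rewrite indicE; case: (boolP (x \in X i)) => // /set_mem Xi.
by move: ii0; rewrite (tX i i0 Logic.I Logic.I) ?eqxx//; exists x.
Qed.

End standard_le.

Theorem theorem4p26 (R : realType) (d : measure_display) (T : measurableType d)
    (mu : {measure set T -> \bar R}) (q : R) (hq : 1 <= q)
    (n : nat) (hn : (0 < n)%N) (f : 'I_n -> cL1 mu) :
  standard_multi_norm q f = multi_norm_1q q f.
Proof.
apply/eqP; rewrite eq_le standard_multi_norm_le /=.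
exact: multi_norm_1q_le.
Qed.
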